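(* Let $q$ be an odd prime power and $t>4$ an integer, and put $n=2t$. If $t$ is even and $q>3$, or $t$ is odd and $q>5$, then there exists $m\in\mathbb{F}_{q^t}$ such that \[\varphi_{m,q}=X^{q^{t-1}}+X^{q^{2t-1}}+m\left(X^{q}-X^{q^{t+1}}\right)\in\mathbb{F}_{q^{2t}}[X]\] is a scattered $q$-polynomial which is not equivalent to any polynomial in the following three families of scattered $q$-polynomials in $\mathbb{F}_{q^{2t}}[X]$: (i) $X^{q^s}$ with $\gcd(s,n)=1$ (pseudoregulus type); (ii) $X^{q^{n-s}}+\delta X^{q^s}$ with $\gcd(s,n)=1$ and $\delta^{\frac{q^n-1}{q-1}}\neq 0,1$ (Lunardon–Polverino type); (iii) $\psi_{s,h}=X^{q^s}+X^{q^{s(t-1)}}+h^{1+q^{s}}X^{q^{s(t+1)}}+h^{1-q^{s(2t-1)}}X^{q^{s(2t-1)}}$ with $\gcd(s,2t)=1$, $h\in\mathbb{F}_{q^{2t}}$ and $h^{q^t+1}=-1$.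
   Context: A $q$-polynomial over $\mathbb{F}_{q^n}$ is a polynomial $f=\sum_i a_iX^{q^i}$ with $a_i\in\mathbb{F}_{q^n}$, considered modulo $X^{q^n}-X$, i.e. identified with the $\mathbb{F}_q$-linear map $x\mapsto f(x)$ of $\mathbb{F}_{q^n}$. Such $f$ is scattered if for all $x,y\in\mathbb{F}_{q^n}^*$, $f(x)/x=f(y)/y$ implies $x/y\in\mathbb{F}_q$. The graph of $f$ is $U_f=\{(x,f(x)) : x\in\mathbb{F}_{q^n}\}\subseteq\mathbb{F}_{q^n}^2$. Two $q$-polynomials $f,g$ are equivalent if $U_f$ and $U_g$ lie in the same orbit under the natural action of $\Gamma\mathrm{L}(2,q^n)$ on $\mathbb{F}_{q^n}^2$ (i.e., there are $M\in\mathrm{GL}(2,q^n)$ and a field automorphism $\tau$ of $\mathbb{F}_{q^n}$ with $\{M(x^\tau,f(x)^\tau)^T\}=U_g$). *)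

(* Defs.v *)
From HB Require Import structures.
From mathcomp Require Import all_boot all_order all_algebra all_field.
From mathcomp Require Import boolp classical_sets.

Set Implicit Arguments.
Unset Strict Implicit.
Unset Printing Implicit Defensive.

Import GRing.Theory.
Local Open Scope ring_scope.

(* Throughout, F is F_q and L is F_{q^n}, so F_q sits in L as 1%VS.
   The identification of q-polynomials modulo X^(q^n) - X is taken into account
   by the fact that scatteredness and equivalence only involve f through the
   map x |-> f.[x]. *)

Definition q_polynomial (F : finFieldType) (L : fieldExtType F)
    (f : {poly L}) : Prop :=
  exists (k : nat) (a : nat -> L), f = \sum_(i < k) a i *: 'X^(#|F| ^ i).

Definition scattered (F : finFieldType) (L : fieldExtType F)
    (f : {poly L}) : Prop :=
  forall x y : L, x != 0 -> y != 0 ->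
    f.[x] / x = f.[y] / y -> x / y \in (1%VS : {vspace L}).

Definition graph (L : fieldType) (f : {poly L}) : set 'cV[L]_2 :=
  range (fun x : L => \col_(i < 2) (if i == 0 then x else f.[x])).

(* tau ranges over all field automorphisms of L, not only the F-linear ones. *)
Definition equivalent (L : fieldType) (f g : {poly L}) : Prop :=
  exists (M : 'M[L]_2) (tau : {rmorphism L -> L}),
    [/\ M \in unitmx, bijective tau
      & image (graph f) (fun v => M *m map_mx tau v) = graph g].

Definition phi (L : fieldType) (q t : nat) (m : L) : {poly L} :=
  'X^(q ^ (t - 1)) + 'X^(q ^ (2 * t - 1)) + m *: ('X^q - 'X^(q ^ (t + 1))).

Definition pseudoregulus (L : fieldType) (q s : nat) : {poly L} :=
  'X^(q ^ s).
Arguments pseudoregulus : clear implicits.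

Definition lunardon_polverino (L : fieldType) (q n s : nat) (delta : L) :
    {poly L} :=
  'X^(q ^ (n - s)) + delta *: 'X^(q ^ s).

Definition psi (L : fieldType) (q t s : nat) (h : L) : {poly L} :=
  'X^(q ^ s) + 'X^(q ^ (s * (t - 1)))
  + h ^+ (1 + q ^ s) *: 'X^(q ^ (s * (t + 1)))
  + (h / h ^+ (q ^ (s * (2 * t - 1)))) *: 'X^(q ^ (s * (2 * t - 1))).

(* Main.v *)
(* Let K = F_(q^t), J x = x^(q^t), and L = K + W with W the (-1)-eigenspace of
   J. Then phi_m is 2 x^(q^(t-1)) on K and 2 m x^q on W. This makes phi_m
   scattered as soon as m in K^* has norm N(m) from L to F_q different from 1
   and is not the (q+1)-th power of an element of W.

   An equivalence of phi_m with g amounts, after replacing m by a conjugate, to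
   g(a y + b phi_m(y)) = c y + d phi_m(y) with ad - bc nonzero. Restrict this to
   K and to a line w K in W, and compare coefficients of y^(q^i) for i modulo t.
   All exponents of g are congruent to s or -s. If s is not 1 or -1 modulo t,
   then c = d = 0. If s is 1 or -1 and g has only one term with exponent
   congruent to s, then a = b = 0. For psi_(s,h), the equations that remain say
   that N(m) = 1 unless c = d = 0. *)
From HB Require Import structures.
Require Import Defs.
From mathcomp Require Import all_boot all_order all_algebra all_field.
From mathcomp Require Import cyclic ring zify.

Set Implicit Arguments.
Unset Strict Implicit.
Unset Printing Implicit Defensive.

Import GRing.Theory.
Local Open Scope ring_scope.

(** * Powers of the Frobenius map of F_q and comparison of coefficients on a subfield *)

Definition frob (F : finFieldType) (L : fieldExtType F) (i : nat) (x : L) : L :=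
  x ^+ (#|F| ^ i).

Section Frobenius.
Variables (F : finFieldType) (L : fieldExtType F).
Implicit Types (x y : L) (i j : nat).

Lemma card_pchar_nat i : [pchar L].-nat (#|F| ^ i)%N.
Proof.
have [p p_pr pF] := finPcharP F.
have pL : p \in [pchar L] by rewrite pchar_lalg.
rewrite (eq_pnat _ (pcharf_eq pL)) pnatX; apply/orP; left.
have := card_pprimeChar pF; rewrite -[LHS]/(#|F|) => ->.
by rewrite pnatX pnat_id.
Qed.

Lemma frob_is_zmod_morphism i : zmod_morphism (@frob F L i).
Proof.
by move=> x y; rewrite /frob exprDn_pchar ?exprNn_pchar ?card_pchar_nat.
Qed.

Lemma frob_is_monoid_morphism i : monoid_morphism (@frob F L i).
Proof. by split=> [|x y]; rewrite /frob ?expr1n ?exprMn. Qed.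

HB.instance Definition _ i :=
  GRing.isZmodMorphism.Build L L (frob i) (frob_is_zmod_morphism i).
HB.instance Definition _ i :=
  GRing.isMonoidMorphism.Build L L (frob i) (frob_is_monoid_morphism i).

Lemma frobD i j x : frob i (frob j x) = frob (j + i) x.
Proof. by rewrite /frob -exprM -expnD. Qed.

Lemma frob0 x : frob 0 x = x.
Proof. by rewrite /frob expr1. Qed.

Lemma frob1 x : frob 1 x = x ^+ #|F|.
Proof. by rewrite /frob expn1. Qed.

Lemma frob_fixedE (K : {subfield L}) x : (x \in K) = (frob (\dim K) x == x).
Proof. exact: Fermat's_little_theorem. Qed.

Lemma frob_mod (K : {subfield L}) i x :
  x \in K -> frob i x = frob (i %% \dim K) x.
Proof.
rewrite frob_fixedE => /eqP xK; rewrite {1}(divn_eq i (\dim K)) addnC.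
elim: (_ %/ _)%N => [|k IHk]; first by rewrite addn0.
by rewrite mulSn addnCA -frobD xK.
Qed.

Lemma mem1v_frob x : (x \in (1%VS : {vspace L})) = (frob 1 x == x).
Proof.
by rewrite (Fermat's_little_theorem 1%AS x) dimv1.
Qed.

Lemma vspace_elements (V : {vspace L}) :
  exists s : seq L, [/\ uniq s, s =i V & size s = (#|F| ^ \dim V)%N].
Proof.
exists (enum (V : {vspace finvect_type L})); split; first exact: enum_uniq.
- by move=> x; apply: (mem_enum (V : {vspace finvect_type L})).
- by have := card_vspace (V : {vspace finvect_type L}); rewrite cardE.
Qed.

(* A polynomial of degree at most q^(d-1) cannot vanish on the q^d elements
   of a d-dimensional subspace. *)
Lemma sum_frob_eq0 (V : {vspace L}) (c : nat -> L) :
    (forall z, z \in V -> \sum_(i < \dim V) c i * frob i z = 0) ->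
  forall i, (i < \dim V)%N -> c i = 0.
Proof.
move=> c0 i iV; have q_gt1 : (1 < #|F|)%N := finNzRing_gt1 F.
pose P : {poly L} := \sum_(j < \dim V) c j *: 'X^(#|F| ^ j).
suff P0 : P = 0.
  have := coef0 L (#|F| ^ i); rewrite -P0 coef_sum (bigD1 (Ordinal iV)) //=.
  rewrite coefZ coefXn eqxx mulr1 big1 ?addr0 // => j ji.
  rewrite coefZ coefXn eqn_exp2l // [i == _]eq_sym.
  by rewrite -val_eqE /= in ji; rewrite (negPf ji) mulr0.
have [s [s_uniq sV s_size]] := vspace_elements V.
apply/eqP/contraT => /max_poly_roots/(_ _ s_uniq).
rewrite s_size ltnNge => -/(_ _)/negP; case.
  apply/allP => z; rewrite sV => /c0 zP; rewrite /root horner_sum -[eqbRHS]zP.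
  by apply/eqP/eq_bigr => j _; rewrite hornerZ hornerXn.
apply: leq_trans (size_sum _ _ _) _; apply/bigmax_leqP => j _.
apply: leq_trans (size_scale_leq _ _) _; rewrite size_polyXn.
by rewrite ltn_exp2l.
Qed.

(** On [K] a Frobenius power depends only on its exponent modulo [\dim K], so grouping the terms by
    residue reduces the sum to [sum_frob_eq0]. *)
Lemma sum_frob_eq0_mod (K : {subfield L}) (ts : seq (L * nat)) :
    (forall z, z \in K -> \sum_(p <- ts) p.1 * frob p.2 z = 0) ->
  forall r, (r < \dim K)%N ->
    \sum_(p <- ts | (p.2 %% \dim K)%N == r) p.1 = 0.
Proof.
move=> ts0; have K_gt0 : (0 < \dim K)%N by rewrite adim_gt0.
apply: (@sum_frob_eq0 K (fun r => \sum_(p <- ts | (p.2 %% \dim K)%N == r) p.1)).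
move=> z zK; rewrite -[RHS](ts0 z zK).
under eq_bigr => i _ do rewrite mulr_suml big_mkcond /=.
rewrite exchange_big /=; apply: eq_bigr => p _.
rewrite -big_mkcond /= (frob_mod _ zK).
by rewrite (big_pred1 (Ordinal (ltn_pmod p.2 K_gt0))).
Qed.

(* [g_part G d r] is the part of the q-polynomial [\sum_p p.1 X^(q^p.2)] with
   exponents congruent to [r] modulo [d]. *)
Definition g_part (G : seq (L * nat)) (d r : nat) (x : L) : L :=
  \sum_(p <- G | (p.2 %% d)%N == r) p.1 * frob p.2 x.

Lemma coef_comparison (K : {subfield L}) (G : seq (L * nat)) (k : nat)
    (A B C D : L) :
    (k < \dim K)%N ->
    (forall z, z \in K ->
       \sum_(p <- G) p.1 * frob p.2 (A * z + B * frob k z)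
         = C * z + D * frob k z) ->
  forall r, (r < \dim K)%N ->
    g_part G (\dim K) r A + g_part G (\dim K) ((r + (\dim K - k)) %% \dim K) B
      = (if r == 0%N then C else 0) + (if r == k then D else 0).
Proof.
set t := \dim K => k_lt eqG r r_lt.
(* The whole identity moved to one side, as pairs of a coefficient and a Frobenius exponent in
   [z]. *)
pose ts := [seq (p.1 * frob p.2 A, p.2) | p <- G]
  ++ [seq (p.1 * frob p.2 B, (p.2 + k)%N) | p <- G]
  ++ [:: (- C, 0%N); (- D, k)].
have ts0 z : z \in K -> \sum_(p <- ts) p.1 * frob p.2 z = 0.
  move=> zK; rewrite /ts !big_cat !big_map !big_cons big_nil /= addr0 addrA.
  rewrite -big_split /= !mulNr -opprD frob0 -eqG // -sumrB big1 // => p _.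
  by rewrite rmorphD !rmorphM /= frobD [(k + _)%N]addnC mulrDr !mulrA subrr.
have := sum_frob_eq0_mod ts0 r_lt.
rewrite /ts !big_cat !big_map !big_cons big_nil /= addr0 mod0n.
rewrite (modn_small k_lt) ![_ == r]eq_sym => tsr.
apply/eqP; rewrite -subr_eq0; apply/eqP; rewrite -[RHS]tsr addrA /g_part.
congr (_ + _ + _); last first.
  by case: ifP; case: ifP; rewrite ?addr0 ?add0r ?opprD ?oppr0 ?addr0.
(* The terms from [B] have exponent [p.2 + k], which has residue [r] exactly when [p.2] is congruent
   to [r - k]; adding [t] keeps this difference natural. *)
apply: eq_bigl => p; apply/eqP/eqP => [p2E | <-]; last first.
  by rewrite modnDml -addnA subnKC ?modnDr // ltnW.
by rewrite -modnDml p2E modnDml -addnA subnK ?modnDr ?modn_small // ltnW.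
Qed.
End Frobenius.

(** * The quadratic extension L of K, its skew elements and the norm to F_q *)

Section QuadraticExtension.
Variables (F : finFieldType) (L : fieldExtType F) (K : {subfield L}).
Hypothesis q_odd : odd #|F|.
Hypothesis dimL : \dim {:L} = (2 * \dim K)%N.

Implicit Types (x y w m al : L) (i : nat).

Local Notation q := #|F|.
Local Notation t := (\dim K).

Let t_gt0 : (0 < t)%N. Proof. exact: adim_gt0. Qed.

Lemma two_neq0 : (2 : L) != 0.
Proof.
apply/negP => two0; have q_gt1 : (1 < q)%N := finNzRing_gt1 F.
have ch2 : 2 \in [pchar L] by rewrite inE /=.
have := card_pchar_nat L 1; rewrite expn1 (eq_pnat _ (pcharf_eq ch2)).
case/p_natP => -[|k] qE; first by rewrite qE in q_gt1.
by move: q_odd; rewrite qE oddX.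
Qed.

Lemma mulr2_inj (x y : L) : 2 * x = 2 * y -> x = y.
Proof. exact: (mulfI two_neq0). Qed.

Lemma frob_n x : frob (2 * t) x = x.
Proof. by apply/eqP; rewrite -dimL -(frob_fixedE {:L}%AS) memvf. Qed.

Lemma frob_t2 x : frob t (frob t x) = x.
Proof. by rewrite frobD addnn -mul2n frob_n. Qed.

Lemma frob_modn i x : frob i x = frob (i %% (2 * t)) x.
Proof. by rewrite -dimL -(frob_mod _ (memvf x : x \in {:L}%AS)). Qed.

Lemma memK x : (x \in K) = (frob t x == x).
Proof. exact: frob_fixedE. Qed.

Lemma phiE m x : (phi q t m).[x] =
  frob (t - 1) (x + frob t x) + m * frob 1 (x - frob t x).
Proof.
rewrite /phi !hornerE !rmorphD !rmorphN /= !frobD /frob expn1 addnC.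
by rewrite [(t + (t - 1))%N](_ : _ = (2 * t - 1)%N) //; lia.
Qed.

Lemma skew_exists : exists2 w : L, w != 0 & frob t w = - w.
Proof.
have /subvPn[x _ xK] : ~~ ({:L} <= K)%VS.
  by apply/negP => /dimvS; rewrite dimL mul2n -addnn -[leqRHS]add0n
    leq_add2r leqNgt t_gt0.
exists (x - frob t x); first by rewrite subr_eq0 eq_sym -memK.
by rewrite rmorphB /= frob_t2 opprB.
Qed.

(** The [K]-component is written as [frob 1 al] because [frob (t - 1)] undoes [frob 1] on [K], so
    that [al] appears without a Frobenius power in [phi_split]. *)
Lemma sym_skew_decomposition (x : L) :
  exists al w : L, [/\ al \in K, frob t w = - w & x = frob 1 al + w].
Proof.
exists (frob (t - 1) ((x + frob t x) / 2)), ((x - frob t x) / 2).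
have f2 i : frob i (2 : L) = 2 by rewrite rmorph_nat.
split.
- rewrite memK frobD addnC -frobD fmorph_div rmorphD /= f2 frob_t2.
  by rewrite [frob t x + x]addrC.
- by rewrite fmorph_div rmorphB /= f2 frob_t2 -mulNr opprB.
- rewrite frobD subnK // fmorph_div rmorphD /= f2 frob_t2.
  by field; exact: two_neq0.
Qed.

(* The norm from [L] to [F]. *)
Definition fnorm (x : L) : L := x ^+ ((q ^ (2 * t) - 1) %/ (q - 1)).

Lemma fnormM x y : fnorm (x * y) = fnorm x * fnorm y.
Proof. exact: exprMn. Qed.

Lemma fnorm_neq0 x : x != 0 -> fnorm x != 0.
Proof. exact: expf_neq0. Qed.

Lemma fnorm_exp x : x != 0 -> fnorm (x ^+ (q - 1)) = 1.
Proof.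
move=> x0; rewrite /fnorm -exprM mulnC divnK; last first.
  by rewrite !subn1 predn_exp dvdn_mulr.
apply: (mulfI x0); rewrite -exprS mulr1 -addn1 subnK.
  exact: frob_n.
by rewrite expn_gt0 (ltnW (finNzRing_gt1 F)).
Qed.

Lemma fnorm_frob i x : x != 0 -> fnorm (frob i x) = fnorm x.
Proof.
move=> x0; elim: i => [|i IHi]; first by rewrite frob0.
rewrite -addn1 -frobD frob1 -(subnK (ltnW (finNzRing_gt1 F))) addn1 exprSr.
by rewrite fnormM fnorm_exp ?mul1r // fmorph_eq0.
Qed.

(** * Scatteredness *)

Lemma phi_split m al w : al \in K -> frob t w = - w ->
  (phi q t m).[frob 1 al + w] = 2 * (al + m * frob 1 w).
Proof.
rewrite memK => /eqP alK wW.
have AK : frob t (frob 1 al) = frob 1 al by rewrite frobD addnC -frobD alK.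
have -> : (phi q t m).[frob 1 al + w]
  = frob (t - 1) (2 * frob 1 al) + m * frob 1 (2 * w).
  by rewrite phiE [frob t (_ + _)]rmorphD /= AK wW;
    congr (frob _ _ + m * frob _ _); ring.
rewrite !rmorphM /= !(rmorph_nat (frob _)) frobD addnC subnK // alK.
by ring.
Qed.

(* Write [x = al^q + w] and [y = be^q + v] with [al], [be] in [K] and [w], [v]
   skew.  If [phi x / x = phi y / y], then [E := al v - be w] satisfies
   [E = m E^q], so [E = 0] as [fnorm m != 1]. Put [c := be / al]; then
   [(c^q - c) (al^(q+1) - m w^(q+1)) = 0], and [m] is not the (q+1)-th power
   of the skew element [al / w]. *)
Lemma phi_scattered m : m \in K -> m != 0 -> fnorm m != 1 ->
  (forall w, frob t w = - w -> m != w ^+ q.+1) -> scattered (phi q t m).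
Proof.
move=> mK m0 m_norm m_pow x y.
have frobC i z : frob t (frob i z) = frob i (frob t z) by rewrite !frobD addnC.
have [al [w [alK wW ->]]] := sym_skew_decomposition x.
have [be [v [beK vW ->]]] := sym_skew_decomposition y.
move=> x0 y0 /eqP; rewrite eqr_div //.
rewrite !phi_split // -!mulrA => /eqP/mulr2_inj E1.
have := congr1 (frob t) E1; rewrite !(rmorphM, rmorphD) /= !frobC vW wW.
move: (alK) (beK) (mK); rewrite !memK => /eqP-> /eqP-> /eqP->.
rewrite !rmorphN /=.
set A := frob 1 al in E1 x0 *; set B := frob 1 be in E1 y0 *.
set w' := frob 1 w in E1 *; set v' := frob 1 v in E1 * => E2.
(* [E2] is the image of [E1] under [frob t]. Their sum and difference, halved, give the component of
   [E1] in [K] ([EK]) and its skew component ([EW]). *)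
have EK : al * B + m * w' * v - (be * A + m * v' * w) = 0.
  apply: mulr2_inj; rewrite mulr0 -(subrr ((be + m * v') * (A + w))) -{1}E1.
  apply/eqP; rewrite -subr_eq0; apply/eqP.
  by rewrite -[RHS](subrr ((be + m * - v') * (A + - w))) -{1}E2; ring.
have EW : al * v + m * w' * B - (be * w + m * v' * A) = 0.
  apply: mulr2_inj; rewrite mulr0 -(subrr ((be + m * v') * (A + w))) -{1}E1.
  apply/eqP; rewrite -subr_eq0; apply/eqP.
  by rewrite -[LHS]opprK -[RHS]oppr0
       -(subrr ((be + m * - v') * (A + - w))) -{1}E2; ring.
have [E0 | E0] := eqVneq (al * v - be * w) 0; last first.
  set E := al * v - be * w in E0; case/negP: m_norm; apply/eqP.
  have mE : m * E ^+ (q - 1) = 1.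
    apply: (mulfI E0); rewrite mulr1 mulrCA -exprS -addn1 subnK.
      rewrite -frob1 rmorphB !rmorphM /= -/A -/B -/w' -/v'.
      by apply/eqP; rewrite eq_sym -subr_eq0 -EW /E; apply/eqP; ring.
    exact: ltnW (finNzRing_gt1 F).
  by rewrite -[RHS](expr1n _ ((q ^ (2 * t) - 1) %/ (q - 1))) -mE -/(fnorm _)
       fnormM fnorm_exp ?mulr1.
move/eqP: E0; rewrite subr_eq0 => /eqP E0.
(* The quotient [c] requires [al] nonzero. If [al = 0], then [w] is nonzero, so [be = 0], and [EK]
   becomes [w' * v = v' * w]: the quotient [w / v] is fixed by [frob 1]. *)
have [al0 | al0] := eqVneq al 0.
  have A0 : A = 0 by rewrite /A al0 rmorph0.
  rewrite A0 add0r in x0 *; move/eqP: E0; rewrite al0 mul0r eq_sym mulf_eq0.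
  rewrite (negPf x0) orbF => /eqP be0.
  have B0 : B = 0 by rewrite /B be0 rmorph0.
  rewrite B0 add0r in y0 *; move: EK.
  rewrite al0 be0 !mul0r !add0r -!mulrA -mulrBr => /eqP.
  rewrite mulf_eq0 (negPf m0) subr_eq0 /= => wv.
  by rewrite mem1v_frob fmorph_div /= eqr_div ?fmorph_eq0 // [w * _]mulrC.
pose c := be / al.
have beE : be = c * al by rewrite /c divfK.
have vE : v = c * w by apply: (mulfI al0); rewrite E0 /c; field.
have BE : B = frob 1 c * A by rewrite /B beE rmorphM.
have v'E : v' = frob 1 c * w' by rewrite /v' vE rmorphM.
have : (frob 1 c - c) * (al * A - m * (w * w')) = 0.
  by rewrite -EK beE vE BE v'E; ring.
move/eqP; rewrite mulf_eq0 !subr_eq0 => /orP[/eqP cF | /eqP mE].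
  move: y0; rewrite BE vE cF -mulrDr mulf_eq0 negb_or => /andP[c0 _].
  rewrite invfM mulrCA divff // mulr1 mem1v_frob fmorphV /= cF.
  exact: eqxx.
have A0 : A != 0 by rewrite fmorph_eq0.
have w0 : w != 0.
  apply: contraNneq (mulf_neq0 al0 A0) => w0.
  by rewrite mE w0 mul0r mulr0.
have /m_pow/eqP[] : frob t (al / w) = - (al / w).
  rewrite fmorph_div /= wW; move: alK; rewrite memK => /eqP->.
  by rewrite invrN mulrN.
have w'0 : w' != 0 by rewrite fmorph_eq0.
rewrite exprS -frob1 fmorph_div /= -/A -/w' mulf_div mE.
by field; rewrite w0 w'0.
Qed.

(** * Choice of the parameter m *)

Lemma primitive_element : exists2 k, k \in K & (q ^ t - 1).-primitive_root k.
Proof.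
have [s [s_uniq sK s_size]] := vspace_elements K.
have qt_gt1 : (1 < q ^ t)%N by rewrite -{1}(expn0 q) ltn_exp2l // finNzRing_gt1.
have qt_gt0 : (0 < q ^ t - 1)%N by rewrite subn_gt0.
have : has (q ^ t - 1).-primitive_root (rem 0 s).
  apply: has_prim_root => //; last 2 first.
  - exact: rem_uniq.
  - by rewrite size_rem ?sK ?mem0v // s_size subn1.
  apply/allP => x; rewrite mem_rem_uniq // inE sK memK => /andP[x0 /eqP xK].
  apply/unity_rootP; apply: (mulfI x0); rewrite mulr1 -exprS -addn1 subnK //.
  exact: ltnW.
by case/hasP => k /mem_rem; rewrite sK; exists k.
Qed.

Lemma skew_exp w : w != 0 -> frob t w = - w -> w ^+ (q ^ t - 1) = -1.
Proof.
move=> w0 wW; apply: (mulfI w0); rewrite -exprS -addn1 subnK ?mulrN1 //.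
by rewrite expn_gt0 (ltnW (finNzRing_gt1 F)).
Qed.

(** The norm exponent is [d * (q ^ t + 1)] with [d * (q - 1) = q ^ t - 1]. Norm 1 would thus mean
    that [q - 1] divides [i * (q ^ t + 1)], hence [2 * i], as [q ^ t] is 1 modulo [q - 1]. *)
Lemma fnorm_primitive_neq1 k i : (q ^ t - 1).-primitive_root k ->
  (0 < i)%N -> (2 * i < q - 1)%N -> fnorm (k ^+ i) != 1.
Proof.
move=> k_prim i_gt0 i_lt; rewrite /fnorm -exprM -(prim_order_dvd k_prim).
have q_gt1 : (1 < q)%N := finNzRing_gt1 F.
have q1_dvd : (q - 1 %| q ^ t - 1)%N by rewrite !subn1 predn_exp dvdn_mulr.
have qt_gt1 : (1 < q ^ t)%N by rewrite -{1}(expn0 q) ltn_exp2l.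
have -> : ((q ^ (2 * t) - 1) %/ (q - 1)
           = (q ^ t - 1) %/ (q - 1) * (q ^ t + 1))%N.
  by rewrite divn_mulAC // -subn_sqr exp1n mul2n -addnn expnD mulnn.
set d := ((q ^ t - 1) %/ (q - 1))%N; have dE : (d * (q - 1) = q ^ t - 1)%N.
  by rewrite divnK.
have d_gt0 : (0 < d)%N.
  by move: qt_gt1; rewrite -subn_gt0 -dE muln_gt0 => /andP[].
rewrite -{1}dE mulnCA dvdn_pmul2l // mulnDr muln1.
have -> : (q ^ t = (q ^ t - 1) + 1)%N by rewrite subnK // ltnW.
rewrite mulnDr -addnA dvdn_addr ?dvdn_mull // muln1 addnn -mul2n.
by rewrite gtnNdvd // muln_gt0.
Qed.

(* [m] is a generator [k] of the multiplicative group of [K], or [k^2] when [t]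
   is odd and [q] is 1 mod 4: if [m = w^(q+1)] with [w] skew, then
   [w^(q^t - 1) = -1] determines a power of [m] that a generator cannot have. *)
Lemma good_parameter_exists :
    (~~ odd t /\ (3 < q)%N) \/ (odd t /\ (5 < q)%N) ->
  exists m, [/\ m \in K, m != 0, fnorm m != 1
    & forall w, frob t w = - w -> m != w ^+ q.+1].
Proof.
move=> hqt; have q_gt1 : (1 < q)%N := finNzRing_gt1 F.
have qt_gt1 : (1 < q ^ t)%N by rewrite -{1}(expn0 q) ltn_exp2l.
have N1 : (1 : L) != -1.
  by rewrite -subr_eq0 opprK -[1 + 1]/(2 : L) two_neq0.
have [k kK k_prim] := primitive_element.
have k0 : k != 0.
  apply/eqP => k0; have /eqP := prim_expr_order k_prim.
  by rewrite k0 expr0n subn_eq0 leqNgt qt_gt1 /= eq_sym oner_eq0.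
suff [i [i_gt0 i_lt ki]] : exists i, [/\ (0 < i)%N, (2 * i < q - 1)%N
    & forall w, w != 0 -> frob t w = - w -> k ^+ i != w ^+ q.+1].
  exists (k ^+ i); split.
  - exact: rpredX.
  - exact: expf_neq0.
  - exact: fnorm_primitive_neq1.
  - move=> w wW; have [-> | w0] := eqVneq w 0; last exact: ki.
    by rewrite expr0n expf_neq0.
case: hqt => -[t_par q_gt].
- exists 1; split=> //; first by lia.
  move=> w w0 wW; rewrite expr1; apply/eqP => kE.
  (* For even [t], put [e = (q ^ t - 1) / (q + 1)]. Then [k ^+ e = w ^+ (q ^ t - 1) = -1], so the
     order [(q + 1) * e] of [k] divides [2 * e], which is absurd. *)
  have q1_dvd : (q.+1 %| q ^ t - 1)%N.
    rewrite -(odd_double_half t) (negPf t_par) add0n -mul2n expnM.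
    apply: (@dvdn_trans (q ^ 2 - 1)); last first.
      by rewrite !subn1 [X in (_ %| X)%N]predn_exp dvdn_mulr.
    by rewrite -{2}(exp1n 2) subn_sqr addn1 dvdn_mull.
  set e := ((q ^ t - 1) %/ q.+1)%N; have eE : (q.+1 * e = q ^ t - 1)%N.
    by rewrite mulnC divnK.
  have ke : k ^+ e = -1 by rewrite kE -exprM eE skew_exp.
  have e_gt0 : (0 < e)%N by move: qt_gt1; rewrite -subn_gt0 -eE muln_gt0.
  have : (q ^ t - 1 %| e * 2)%N.
    by rewrite (prim_order_dvd k_prim) exprM ke sqrrN expr1n.
  rewrite -eE mulnC dvdn_pmul2l // gtnNdvd //; by lia.
have qt_odd : odd (q ^ t) by rewrite oddX q_odd orbT.
set e := ((q ^ t - 1)./2)%N; have eE : (e * 2 = q ^ t - 1)%N.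
  by rewrite muln2 even_halfK // oddB ?(ltnW qt_gt1) // qt_odd.
have e_gt0 : (0 < e)%N.
  by move: qt_gt1; rewrite -subn_gt0 -eE muln_gt0 => /andP[].
clearbody e; have ke : k ^+ e = -1.
  have /eqP : (k ^+ e) ^+ 2 = 1 by rewrite -exprM eE prim_expr_order.
  rewrite sqrf_eq1 -(prim_order_dvd k_prim) gtnNdvd //=.
    by move/eqP.
  by rewrite -eE muln2 -addnn -{1}[e]addn0 ltn_add2l.
(* Raising [k ^+ i = w ^+ q.+1] to the power [e] gives [(-1) ^ i = (-1) ^ ((q + 1) / 2)], so [i] is
   chosen of the opposite parity. The choice [i = 2] satisfies [2 * i < q - 1] because [q > 5]. *)
have [i [i_gt0 i_lt i_odd]] : exists i,
    [/\ (0 < i)%N, (2 * i < q - 1)%N & odd i = ~~ odd q.+1./2].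
  by have [qo | qo] := boolP (odd q.+1./2); [exists 2 | exists 1];
    split; rewrite ?qo //; lia.
exists i; split=> // w w0 wW; apply/eqP => kE.
have := congr1 (fun z => z ^+ e) kE; rewrite -exprM mulnC exprM ke -exprM.
have -> : (q.+1 * e = (q ^ t - 1) * q.+1./2)%N.
  have hE : (2 * q.+1./2 = q.+1)%N by rewrite mul2n even_halfK //= negbK.
  by rewrite -eE -mulnA hE mulnC.
rewrite exprM skew_exp // -signr_odd i_odd -[RHS]signr_odd.
by case: (odd _) => /= /eqP; rewrite ?expr1 ?expr0 ?(negPf N1) //
  eq_sym (negPf N1).
Qed.

(** * Coefficient equations forced by an equivalence *)

Section Intertwining.
Variables (G : seq (L * nat)) (m a b c d : L).
Hypothesis t_gt4 : (4 < t)%N.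
Hypothesis intertwine : forall y,
  \sum_(p <- G) p.1 * frob p.2 (a * y + b * (phi q t m).[y])
    = c * y + d * (phi q t m).[y].

(* On [K] the map [phi m] is [2 z^(q^(t-1))]; on a line [w K] with
   [w^(q^t) = - w] it is [w z |-> 2 m w^q z^q]. *)
Lemma sym_part r : (r < t)%N ->
  g_part G t r a + g_part G t ((r + 1) %% t) (2 * b)
    = (if r == 0%N then c else 0) + (if r == (t - 1)%N then 2 * d else 0).
Proof.
move=> r_lt; have k_lt : (t - 1 < t)%N by rewrite subn1 prednK.
have := @coef_comparison F L K G (t - 1) a (2 * b) c (2 * d) k_lt _ r r_lt.
rewrite subKn //; apply=> z; rewrite memK => /eqP zK; have := intertwine z.
have -> : (phi q t m).[z] = 2 * frob (t - 1) z.
  by rewrite phiE zK subrr rmorph0 mulr0 addr0 rmorphD /=; ring.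
by rewrite !mulrA ![_ * 2]mulrC => ->.
Qed.

Lemma skew_part w r : frob t w = - w -> (r < t)%N ->
  g_part G t r (a * w)
    + g_part G t ((r + (t - 1)) %% t) (2 * b * (m * frob 1 w))
    = (if r == 0%N then c * w else 0)
      + (if r == 1%N then 2 * d * (m * frob 1 w) else 0).
Proof.
move=> wW r_lt; apply: coef_comparison => //; first by apply: leq_trans t_gt4.
move=> z; rewrite memK => /eqP zK; have := intertwine (w * z).
have -> : (phi q t m).[w * z] = 2 * (m * frob 1 w) * frob 1 z.
  rewrite phiE rmorphM /= wW zK mulNr subrr rmorph0 add0r opprK.
  by rewrite rmorphD !rmorphM /=; ring.
have -> : a * (w * z) + b * (2 * (m * frob 1 w) * frob 1 z)
  = a * w * z + 2 * b * (m * frob 1 w) * frob 1 z by ring.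
by move=> ->; ring.
Qed.

Lemma g_part_eq0 r x :
  {in G, forall p, (p.2 %% t)%N != r} -> g_part G t r x = 0.
Proof.
by move=> Gr; rewrite /g_part big_seq_cond big1 // => p /andP[/Gr/negPf->].
Qed.

(* The exponents contributed by [b] are congruent to [p.2 - 1], so no term on
   the left-hand side has an exponent congruent to [0] or [t - 1]. *)
Lemma intertwine_generic :
    {in G, forall p, (p.2 %% t)%N \notin [:: 0; 1; t - 1]%N} ->
  c = 0 /\ d = 0.
Proof.
move=> G_exp; have part0 r x : r \in [:: 0; 1; t - 1]%N -> g_part G t r x = 0.
  by move=> rE; apply: g_part_eq0 => p /G_exp; apply: contraNneq => ->.
have t1 : (t - 1 == 0)%N = false by lia.
split; [have := @sym_part 0 t_gt0 | have := @sym_part (t - 1)].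
  rewrite modn_small ?(leq_trans _ t_gt4) // !part0 ?inE //= addr0.
  by rewrite [_ == _]eq_sym t1 /= addr0 => <-.
rewrite subnK // modnn !part0 ?inE ?eqxx ?orbT // t1 /= !add0r => dE.
by apply: mulr2_inj; rewrite mulr0 -dE // subn1 prednK.
Qed.

Hypothesis G_exp : {in G, forall p, (p.2 %% t)%N \in [:: 1; t - 1]%N}.

Let part0 r x : r \notin [:: 1; t - 1]%N -> g_part G t r x = 0.
Proof.
by move=> rE; apply: g_part_eq0 => p /G_exp; apply: contraTneq => ->.
Qed.

(** These are the residues 1, 0, [t - 1] and [t - 2] of [sym_part]. In each of them only one term on
    the left survives, since [t > 4] keeps 0, 1, 2, [t - 2] and [t - 1] distinct. *)
Lemma sym_parts :
  [/\ g_part G t 1 a = 0, g_part G t 1 (2 * b) = c,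
      g_part G t (t - 1) a = 2 * d & g_part G t (t - 1) (2 * b) = 0].
Proof.
have t_ne i : (i < 4)%N -> (i == t - 1)%N = false by lia.
have small i : (i < 4)%N -> (i < t)%N by lia.
split.
- have := @sym_part 1 (small 1%N isT).
  rewrite modn_small ?small // [X in _ + X]part0 ?inE ?t_ne //=.
  by rewrite !addr0.
- have := @sym_part 0 t_gt0.
  rewrite modn_small ?small // [X in X + _]part0 ?inE ?t_ne //=.
  by rewrite add0r addr0.
- have := @sym_part (t - 1); rewrite subnK // modnn eqxx.
  rewrite [X in _ + X]part0 ?inE ?t_ne // [(t - 1)%N == 0%N]eq_sym t_ne //.
  by rewrite addr0 add0r; apply; rewrite subn1 prednK.
- have := @sym_part (t - 2); rewrite modn_small; last by lia.
  rewrite [X in X + _]part0 ?inE; last by lia.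
  rewrite [(t - 2 + 1)%N](_ : _ = (t - 1)%N); last by lia.
  rewrite add0r => ->; last by lia.
  rewrite [(t - 2 == 0)%N](_ : _ = false); last by lia.
  rewrite [(t - 2 == t - 1)%N](_ : _ = false); last by lia.
  by rewrite addr0.
Qed.

(** The same reading of [skew_part], at the residues 1, 2, [t - 1] and 0. *)
Lemma skew_parts w (u := m * frob 1 w) : frob t w = - w ->
  [/\ g_part G t 1 (a * w) = 2 * d * u, g_part G t 1 (2 * b * u) = 0,
      g_part G t (t - 1) (a * w) = 0 & g_part G t (t - 1) (2 * b * u) = c * w].
Proof.
move=> wW; have t_ne i : (i < 4)%N -> (i == t - 1)%N = false by lia.
have small i : (i < 4)%N -> (i < t)%N by lia.
split.
- have := @skew_part w 1 wW (small 1%N isT); rewrite subnKC // modnn.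
  by rewrite [X in _ + X]part0 ?inE ?t_ne //= addr0 add0r.
- have := @skew_part w 2 wW (small 2%N isT).
  rewrite addnBA // addnC -addnBA // modnDl modn_small ?small //.
  by rewrite [X in X + _]part0 ?inE ?t_ne //= !add0r.
- have := @skew_part w (t - 1) wW.
  rewrite [(t - 1 + _)%N](_ : _ = (t - 2) + t)%N; last by lia.
  rewrite modnDr modn_small; last by lia.
  rewrite [X in _ + X]part0 ?inE; last by lia.
  rewrite [(t - 1 == 0)%N](_ : _ = false); last by lia.
  rewrite [(t - 1 == 1)%N](_ : _ = false); last by lia.
  by rewrite !addr0; apply; rewrite subn1 prednK.
- have := @skew_part w 0 wW t_gt0.
  rewrite add0n modn_small; last by rewrite subn1 prednK.
  by rewrite [X in X + _]part0 ?inE ?t_ne //= add0r addr0.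
Qed.

Hypothesis m0 : m != 0.

(** Each of the two parts vanishes once at a multiple of [a] and once at a multiple of [b], one
    equation coming from [sym_parts] and the other from [skew_parts]. Trivial kernel of either part
    therefore kills both. *)
Lemma intertwine_monomial :
    (forall x, g_part G t 1 x = 0 -> x = 0)
    \/ (forall x, g_part G t (t - 1) x = 0 -> x = 0) ->
  a = 0 /\ b = 0.
Proof.
have [w w0 wW] := skew_exists.
have [aP _ _ bM] := sym_parts; have [_ bP aM _] := skew_parts wW.
case=> inj; split.
- exact: inj.
- move/inj/eqP: bP; rewrite !mulf_eq0 fmorph_eq0 (negPf m0) (negPf w0).
  by rewrite (negPf two_neq0) !orbF => /eqP.
- by move/inj/eqP: aM; rewrite mulf_eq0 (negPf w0) orbF => /eqP.
- by move/inj/eqP: bM; rewrite mulf_eq0 (negPf two_neq0) => /eqP.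
Qed.

Hypothesis mK : m \in K.
Hypothesis m_norm : fnorm m != 1.

(* [u := m w^q] and [w] are both skew, so eliminating [eta] and [zeta] from the
   eight coefficient equations leaves
   [frob e (a w) = d u = frob f a * u] and [frob f (b u) = frob e b * w];
   taking norms, either one with [a != 0], resp. [b != 0], gives
   [fnorm m = 1]. *)
Lemma intertwine_binomial e f (eta zeta : L) :
    (forall x, g_part G t 1 x = frob e x + eta * frob (e + t) x) ->
    (forall x, g_part G t (t - 1) x = frob f x + zeta * frob (f + t) x) ->
  c = 0 /\ d = 0.
Proof.
move=> P_E M_E; have [w w0 wW] := skew_exists; pose u := m * frob 1 w.
have u0 : u != 0 by rewrite mulf_neq0 ?fmorph_eq0.
have uW : frob t u = - u.
  rewrite rmorphM /= frobD addnC -frobD wW rmorphN /= mulrN.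
  by move: mK; rewrite memK => /eqP->.
have frobW i (v : L) : frob t v = - v -> frob (i + t) v = - frob i v.
  by move=> vW; rewrite addnC -frobD vW rmorphN.
have f2 i : frob i (2 : L) = 2 by rewrite rmorph_nat.
have [aP bP aM bM] := sym_parts; have [awP buP awM buM] := skew_parts wW.
rewrite -/u !P_E !M_E in aP bP aM bM awP buP awM buM.
have fnorm_u : fnorm u = fnorm m * fnorm w by rewrite fnormM fnorm_frob.
clearbody u; rewrite !rmorphM /= !(frobW _ w wW, frobW _ u uW) !f2
  in bP bM awP buP awM buM.
(* Since [frob t] negates [w] and [u], the terms with [eta] and [zeta] carry opposite signs in the
   symmetric and the skew equations. The vanishing equations express them through [frob e] and
   [frob f], and the others then lose them. *)
have aPE : eta * frob (e + t) a = - frob e a by rewrite (addr0_eq aP).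
have bME : zeta * frob (f + t) b = - frob f b.
  by apply: mulr2_inj; rewrite mulrN (addr0_eq bM); ring.
have aME : zeta * frob (f + t) a = frob f a.
  have : (frob f a - zeta * frob (f + t) a) * frob f w = 0.
    by rewrite -awM; ring.
  by move/eqP; rewrite mulf_eq0 fmorph_eq0 (negPf w0) orbF subr_eq0 => /eqP.
have bPE : eta * frob (e + t) b = frob e b.
  have : 2 * ((frob e b - eta * frob (e + t) b) * frob e u) = 0.
    by rewrite -buP; ring.
  move/eqP; rewrite !mulf_eq0 fmorph_eq0 (negPf u0) (negPf two_neq0) orbF /=.
  by rewrite subr_eq0 => /eqP.
have dE : d = frob f a by apply: mulr2_inj; rewrite -aM aME; ring.
have cE : c = 2 * (2 * frob e b).
  by rewrite -bP [eta * _]mulrCA bPE; ring.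
have a_du : frob e (a * w) = d * u.
  apply: mulr2_inj; rewrite mulrA -awP rmorphM /= mulrA [eta * _]mulrA aPE.
  by ring.
have b_cw : frob f (b * u) = frob e b * w.
  apply/mulr2_inj/mulr2_inj; have -> : 2 * (2 * (frob e b * w)) = c * w.
    by rewrite cE; ring.
  rewrite -buM rmorphM /=.
  have -> : zeta * (2 * frob (f + t) b * - frob f u)
    = - (2 * (zeta * frob (f + t) b) * frob f u) by ring.
  by rewrite bME; ring.
have norm_contra z : fnorm z * fnorm w = fnorm z * fnorm u -> z = 0.
  rewrite fnorm_u mulrCA -[LHS]mul1r => E; apply: contraNeq m_norm => z0.
  apply/eqP; apply: (@mulIf _ (fnorm z * fnorm w)); last first.
    by rewrite mul1r -E mul1r.
  by rewrite mulf_neq0 ?fnorm_neq0.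
split.
- suff b0 : b = 0 by rewrite cE b0 rmorph0 !mulr0.
  have [//|b0] := eqVneq b 0; apply: norm_contra.
  rewrite -(fnorm_frob e b0) -fnormM -b_cw fnorm_frob ?mulf_neq0 // fnormM.
  by rewrite fnorm_frob.
- suff a0 : a = 0 by rewrite dE a0 rmorph0.
  have [//|a0] := eqVneq a 0; apply: norm_contra.
  rewrite -fnormM -(fnorm_frob e) ?mulf_neq0 // a_du fnormM dE.
  by rewrite fnorm_frob.
Qed.
End Intertwining.

End QuadraticExtension.

(** * From equivalence to intertwining, and inequivalence criteria *)

Lemma det_mx2 (R : comNzRingType) (A : 'M[R]_2) :
  \det A = A 0 0 * A 1 1 - A 0 1 * A 1 0.
Proof.
have l01 : lift ord0 ord0 = 1 :> 'I_2 by apply/val_inj.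
have l10 : lift 1 0 = 0 :> 'I_2 by apply/val_inj.
rewrite (expand_det_row A 0) !big_ord_recl big_ord0 /cofactor !det_mx11 !mxE.
rewrite ?l01 ?l10 /= -[ord0]/(0 : 'I_2).
by rewrite modn_small // !add0n expr0 expr1; ring.
Qed.

Section Inequivalence.
Variables (F : finFieldType) (L : fieldExtType F) (K : {subfield L}).
Hypothesis q_odd : odd #|F|.
Hypothesis dimL : \dim {:L} = (2 * \dim K)%N.
Hypothesis t_gt4 : (4 < \dim K)%N.
Local Notation q := #|F|.
Local Notation t := (\dim K).

(** The automorphism [tau] carries the graph of [phi_m] to that of [phi_(tau m)], so it is absorbed
    by taking [m' = tau m]; [a], [b], [c], [d] are the entries of [M]. The conditions on [m] persist
    because they are stated by powers, which commute with [tau]. *)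
Lemma equivalent_intertwine m g (G : seq (L * nat)) :
    (forall x, g.[x] = \sum_(p <- G) p.1 * frob p.2 x) ->
    m \in K -> m != 0 -> fnorm K m != 1 -> equivalent (phi q t m) g ->
  exists m' a b c d : L,
    [/\ m' \in K, m' != 0, fnorm K m' != 1, a * d != b * c
      & forall y, \sum_(p <- G) p.1 * frob p.2 (a * y + b * (phi q t m').[y])
          = c * y + d * (phi q t m').[y]].
Proof.
move=> gE mK m0 m_norm [M [tau [M_unit [sigma _ tauK] graphE]]].
exists (tau m), (M 0 0), (M 0 1), (M 1 0), (M 1 1); split.
- by move: mK; rewrite !(frob_fixedE K) /frob -rmorphXn /=; move/eqP->.
- by rewrite fmorph_eq0.
- by rewrite /fnorm -rmorphXn /= fmorph_eq1.
- by move: M_unit; rewrite unitmxE det_mx2 unitfE subr_eq0.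
move=> y; rewrite -gE.
have tau_phi x : tau (phi q t m).[x] = (phi q t (tau m)).[tau x].
  by rewrite /phi !hornerE !rmorphD rmorphM rmorphB !rmorphXn.
(* The graph point over [sigma y], whose image under [tau] has first coordinate [y]. *)
pose v : 'cV[L]_2 := \col_(i < 2)
  (if i == 0 then sigma y else (phi q t m).[sigma y]).
have : graph g (M *m map_mx tau v).
  by rewrite -graphE; exists v => //; exists (sigma y).
case=> x _ /matrixP vE; have := vE 0 0; have := vE 1 0.
rewrite !mxE !big_ord_recl !big_ord0 !mxE /= !addr0 tau_phi tauK.
rewrite (_ : lift _ _ = 1 :> 'I_2); last exact/val_inj.
by move=> gx xE; rewrite -gx xE.
Qed.


Lemma not_equivalent_generic m g (G : seq (L * nat)) :
    (forall x, g.[x] = \sum_(p <- G) p.1 * frob p.2 x) ->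
    {in G, forall p, (p.2 %% t)%N \notin [:: 0; 1; t - 1]%N} ->
    m \in K -> m != 0 -> fnorm K m != 1 ->
  ~ equivalent (phi q t m) g.
Proof.
move=> gE G_exp mK m0 m_norm.
case/(equivalent_intertwine gE mK m0 m_norm) => m' [a [b [c [d]]]].
case=> m'K m'0 m'_norm det_neq0 E.
have [c0 d0] : c = 0 /\ d = 0.
  exact: (intertwine_generic q_odd dimL t_gt4 E G_exp).
by move: det_neq0; rewrite c0 d0 !mulr0 eqxx.
Qed.

Lemma not_equivalent_monomial m g (G : seq (L * nat)) :
    (forall x, g.[x] = \sum_(p <- G) p.1 * frob p.2 x) ->
    {in G, forall p, (p.2 %% t)%N \in [:: 1; t - 1]%N} ->
    (forall x, g_part G t 1 x = 0 -> x = 0)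
      \/ (forall x, g_part G t (t - 1) x = 0 -> x = 0) ->
    m \in K -> m != 0 -> fnorm K m != 1 ->
  ~ equivalent (phi q t m) g.
Proof.
move=> gE G_exp G_inj mK m0 m_norm.
case/(equivalent_intertwine gE mK m0 m_norm) => m' [a [b [c [d]]]].
case=> m'K m'0 m'_norm det_neq0 E.
have [a0 b0] : a = 0 /\ b = 0.
  exact: (intertwine_monomial q_odd dimL t_gt4 E G_exp m'0 G_inj).
by move: det_neq0; rewrite a0 b0 !mul0r eqxx.
Qed.

Lemma not_equivalent_binomial m g (G : seq (L * nat)) e f eta zeta :
    (forall x, g.[x] = \sum_(p <- G) p.1 * frob p.2 x) ->
    {in G, forall p, (p.2 %% t)%N \in [:: 1; t - 1]%N} ->
    (forall x, g_part G t 1 x = frob e x + eta * frob (e + t) x) ->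
    (forall x, g_part G t (t - 1) x = frob f x + zeta * frob (f + t) x) ->
    m \in K -> m != 0 -> fnorm K m != 1 ->
  ~ equivalent (phi q t m) g.
Proof.
move=> gE G_exp P_E M_E mK m0 m_norm.
case/(equivalent_intertwine gE mK m0 m_norm) => m' [a [b [c [d]]]].
case=> m'K m'0 m'_norm det_neq0 E.
have [c0 d0] : c = 0 /\ d = 0.
  exact: (intertwine_binomial q_odd dimL t_gt4 E G_exp m'0
    m'K m'_norm P_E M_E).
by move: det_neq0; rewrite c0 d0 !mulr0 eqxx.
Qed.

Lemma modn_opp (e s d : nat) : (0 < s %% d)%N -> ((e + s) %% d = 0)%N ->
  (e %% d = d - s %% d)%N.
Proof.
case: d => [|d] s_gt0; first by rewrite !modn0 in s_gt0 *; lia.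
rewrite modnD //; have := ltn_pmod e (ltn0Sn d); have := ltn_pmod s (ltn0Sn d).
by case: leqP => /=; lia.
Qed.

Lemma coprime_modn_gt0 s : coprime s (2 * t) -> (0 < s %% t)%N.
Proof.
rewrite coprimeMr => /andP[_]; rewrite lt0n; apply: contraTneq => st.
by rewrite -coprime_modl st /coprime gcd0n; apply: contraTneq t_gt4 => ->.
Qed.

(** * The three families *)

Section Families.
Variables (m : L) (s : nat).
Hypothesis mK : m \in K.
Hypothesis m0 : m != 0.
Hypothesis m_norm : fnorm K m != 1.
Hypothesis s_coprime : coprime s (2 * t).

Let s_gt0 : (0 < s %% t)%N. Proof. exact: coprime_modn_gt0. Qed.
Let s_lt : (s %% t < t)%N. Proof. by rewrite ltn_pmod // adim_gt0. Qed.
Let t1_neq1 : (t - 1 == 1)%N = false.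
Proof. by apply/eqP; move: t_gt4; lia. Qed.

Lemma not_equivalent_pseudoregulus :
  ~ equivalent (phi q t m) (pseudoregulus L q s).
Proof.
have gE x : (pseudoregulus L q s).[x]
    = \sum_(p <- [:: (1 : L, s)]) p.1 * frob p.2 x.
  by rewrite big_seq1 mul1r /pseudoregulus hornerXn.
have [s_exp | s_exp] := boolP ((s %% t)%N \in [:: 1; t - 1]%N).
- apply: (not_equivalent_monomial gE) => //.
    by move=> p; rewrite inE => /eqP->.
  move: s_exp; rewrite !inE /g_part => /orP[] /eqP sE; [left | right] => x;
    by rewrite big_cons big_nil /= sE eqxx addr0 mul1r => /eqP;
       rewrite fmorph_eq0 => /eqP.
- apply: (not_equivalent_generic gE) => // p; rewrite inE => /eqP->.
  by rewrite inE negb_or s_exp -lt0n s_gt0.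
Qed.

(** The exponents [2 * t - s] and [s] have opposite residues modulo [t]. When these are 1 and
    [t - 1], each part is a single nonzero monomial, hence has trivial kernel. *)
Lemma not_equivalent_lunardon_polverino delta : (s < 2 * t)%N -> delta != 0 ->
  ~ equivalent (phi q t m) (lunardon_polverino q (2 * t) s delta).
Proof.
move=> s_le delta0; set r := (2 * t - s)%N.
have rE : (r %% t = t - s %% t)%N.
  by apply: modn_opp => //; rewrite subnK ?modnMl // ltnW.
have gE x : (lunardon_polverino q (2 * t) s delta).[x]
    = \sum_(p <- [:: (1 : L, r); (delta, s)]) p.1 * frob p.2 x.
  by rewrite !big_cons big_nil addr0 mul1r /lunardon_polverino !hornerE.
have [s_exp | s_exp] := boolP ((s %% t)%N \in [:: 1; t - 1]%N).
- apply: (not_equivalent_monomial gE) => //.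
    move=> p; rewrite !inE => /orP[] /eqP->; rewrite /= ?rE //;
    by move: s_exp s_lt; rewrite !inE; lia.
  move: s_exp; rewrite !inE /g_part => /orP[] /eqP sE; [left | right] => x;
    rewrite !big_cons big_nil /= rE sE eqxx.
    rewrite t1_neq1 addr0 => /eqP.
    by rewrite mulf_eq0 (negPf delta0) fmorph_eq0 => /eqP.
  rewrite subKn ?[(1 == _)%N]eq_sym ?t1_neq1 ?addr0; last exact: adim_gt0.
  by move/eqP; rewrite mulf_eq0 (negPf delta0) fmorph_eq0 => /eqP.
- apply: (not_equivalent_generic gE) => // p.
  rewrite !inE => /orP[] /eqP->; rewrite /= ?rE;
  by move: s_exp s_gt0 s_lt; rewrite !inE; lia.
Qed.

(** As [s] is odd, [s * t] is congruent to [t] modulo [2 * t]. The exponents thus form two pairs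
    differing by [t], namely [s], [s + t] and [s * (t - 1)], [s * (t - 1) + t], with opposite
    residues modulo [t]: the shape required by the binomial criterion. *)
Lemma not_equivalent_psi h : ~ equivalent (phi q t m) (psi q t s h).
Proof.
have t_gt0 : (0 < t)%N := adim_gt0 K.
pose eta := h ^+ (1 + q ^ s); pose zeta := h / h ^+ (q ^ (s * (2 * t - 1))).
pose G := [:: (1 : L, s); (1, (s * (t - 1))%N); (eta, (s * (t + 1))%N);
  (zeta, (s * (2 * t - 1))%N)].
have gE x : (psi q t s h).[x] = \sum_(p <- G) p.1 * frob p.2 x.
  by rewrite !big_cons big_nil addr0 !mul1r /psi !hornerE /frob /= ?addrA.
have e2 : (s * (t - 1) %% t = t - s %% t)%N.
  by apply: modn_opp => //; rewrite addnC -mulnS subn1 prednK // modnMl.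
have e3 : (s * (t + 1) %% t = s %% t)%N by rewrite mulnDr muln1 modnMDl.
have e4 : (s * (2 * t - 1) %% t = t - s %% t)%N.
  apply: modn_opp => //; rewrite addnC -mulnS subn1 prednK ?muln_gt0 //.
  by rewrite mulnA modnMl.
have s_odd : odd s.
  by move: s_coprime; rewrite coprimeMr coprimen2 => /andP[].
have stE : (s * t = s./2 * (2 * t) + t)%N.
  by rewrite -{1}(odd_double_half s) s_odd -mul2n; lia.
have frob_st e (x : L) : frob (e + s * t) x = frob (e + t) x.
  by rewrite stE addnCA (frob_modn dimL) modnMDl -(frob_modn dimL).
have frob3 (x : L) : frob (s * (t + 1)) x = frob (s + t) x.
  by rewrite mulnDr muln1 addnC frob_st.
have frob4 (x : L) : frob (s * (2 * t - 1)) x = frob (s * (t - 1) + t) x.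
  by rewrite -frob_st -mulnDr; congr (frob (s * _) _); lia.
have [s_exp | s_exp] := boolP ((s %% t)%N \in [:: 1; t - 1]%N); last first.
  apply: (not_equivalent_generic gE) => // p.
  rewrite !inE => /or4P[] /eqP->; rewrite /= ?e2 ?e3 ?e4;
  by move: s_exp s_gt0 s_lt; rewrite !inE; lia.
have G_exp : {in G, forall p, (p.2 %% t)%N \in [:: 1; t - 1]%N}.
  move=> p; rewrite !inE => /or4P[] /eqP->; rewrite /= ?e2 ?e3 ?e4;
  by move: s_exp s_lt; rewrite !inE; lia.
move: s_exp; rewrite !inE => /orP[] /eqP sE.
- apply: (@not_equivalent_binomial _ _ G s (s * (t - 1)) eta zeta) => // x;
    rewrite /g_part !big_cons big_nil /= e2 e3 e4 sE ?eqxx ?t1_neq1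
      ?[(1 == _)%N]eq_sym ?t1_neq1 addr0 mul1r.
    by rewrite frob3.
  by rewrite frob4.
(* Here [s] is -1 modulo [t], so the two pairs exchange roles. *)
- have tt : (t - (t - 1) = 1)%N by rewrite subKn.
  apply: (@not_equivalent_binomial _ _ G (s * (t - 1)) s zeta eta) => // x;
    rewrite /g_part !big_cons big_nil /= e2 e3 e4 sE tt ?eqxx ?t1_neq1
      ?[(1 == _)%N]eq_sym ?t1_neq1 addr0 mul1r.
    by rewrite frob4.
  by rewrite frob3.
Qed.
End Families.
End Inequivalence.

(** * Conclusion *)

Lemma phi_q_polynomial (F : finFieldType) (L : fieldExtType F) t (m : L) :
  (0 < t)%N -> q_polynomial (phi #|F| t m).
Proof.
move=> t_gt0; pose X (j : nat) : {poly L} := 'X^(#|F| ^ j).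
pose e (j i : nat) : L := (i == j)%:R.
have XE j : (j < 2 * t + 1)%N -> \sum_(i < 2 * t + 1) e j i *: X i = X j.
  move=> j_lt; rewrite (bigD1 (Ordinal j_lt)) //= /e eqxx scale1r.
  rewrite big1 ?addr0 // => i; rewrite -val_eqE /= => /negPf->.
  by rewrite scale0r.
(* The bound [2 * t + 1] also covers the exponent [t + 1] when [t = 1]. *)
exists (2 * t + 1)%N, (fun i => e (t - 1)%N i + e (2 * t - 1)%N i
  + m * (e 1%N i - e (t + 1)%N i)).
rewrite /phi -[X in m *: ('X^X - _)]expn1 -![X in X = _]/(_ + _).
rewrite -/(X (t - 1)%N) -/(X (2 * t - 1)%N) -/(X 1%N) -/(X (t + 1)%N).
rewrite -!XE; try lia.
rewrite scalerBr !scaler_sumr -sumrB -!big_split /=.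
by apply: eq_bigr => i _; rewrite -/(X i) !scalerDl -scalerA scalerBl scalerBr.
Qed.

Theorem theorem4p7 (F : finFieldType) (L : fieldExtType F)
    (Fqt : {subfield L}) (q t n : nat)
    (hq : q = #|F|) (q_odd : odd q) (ht : (4 < t)%N) (hn : n = (2 * t)%N)
    (dimL : \dim {:L} = n) (dimFqt : \dim Fqt = t)
    (hqt : (~~ odd t /\ (3 < q)%N) \/ (odd t /\ (5 < q)%N)) :
  exists m : L,
    [/\ m \in Fqt,
        q_polynomial (phi q t m) /\ scattered (phi q t m),
        (forall s : nat, coprime s n ->
           ~ equivalent (phi q t m) (pseudoregulus L q s)),
        (forall (s : nat) (delta : L), (s < n)%N -> coprime s n ->
           delta ^+ ((q ^ n - 1) %/ (q - 1)) != 0 ->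
           delta ^+ ((q ^ n - 1) %/ (q - 1)) != 1 ->
           ~ equivalent (phi q t m) (lunardon_polverino q n s delta))
      & (forall (s : nat) (h : L), coprime s n ->
           h ^+ (q ^ t + 1) = -1 ->
           ~ equivalent (phi q t m) (psi q t s h))].
Proof.
subst q n t.
have [m [mK m0 m_norm m_pow]] := good_parameter_exists q_odd dimL hqt.
exists m; split=> //.
- by split; [exact/phi_q_polynomial/adim_gt0 | exact: phi_scattered].
- by move=> s s_coprime; apply: not_equivalent_pseudoregulus.
- move=> s delta s_lt s_coprime d0 d1.
  apply: not_equivalent_lunardon_polverino => //.
  (* A power of zero is 0 or 1, and both values are excluded. *)
  apply: contraNneq d0 => delta0; move: d1; rewrite delta0 expr0n.
  by case: (_ == 0)%N; rewrite ?eqxx.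
- by move=> s h s_coprime _; apply: not_equivalent_psi.
Qed.
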